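(* Assume the $abc$ conjecture holds: for every $\varepsilon>0$ there are only finitely many triples $(a,b,c)$ of pairwise coprime positive integers with $a+b=c$ and $c>\operatorname{rad}(abc)^{1+\varepsilon}$. Then for every $\varepsilon>0$ there exists a constant $K(\varepsilon)>0$ such that $$ n \geq K(\varepsilon)\, 2^{(1-\varepsilon)j} \quad \text{for all integers } j\geq 2 \text{ and all } n\in\mathcal{N}(j).$$
   Context: $\operatorname{rad}(m)$ denotes the product of the distinct prime factors of a positive integer $m$. The Collatz map is $T(n)=(3n+1)/2$ if $n$ is odd and $T(n)=n/2$ if $n$ is even, with $T^0(n)=n$ and $T^{i}$ the $i$-th iterate. For an integer $j\geq 2$, $\mathcal{N}(j)$ is the set of positive integers $n<2^j$ such that among the $j$ terms $n, T(n),\ldots,T^{j-1}(n)$ exactly one is even. *)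

(* Defs.v *)
From HB Require Import structures.
From mathcomp Require Import all_boot all_order all_algebra.
From mathcomp Require Import all_classical all_reals all_analysis.

Set Implicit Arguments.
Unset Strict Implicit.
Unset Printing Implicit Defensive.

Import Order.TTheory GRing.Theory Num.Theory.

Local Open Scope classical_set_scope.
Local Open Scope ring_scope.

(* [primes m] is duplicate-free; the junk value at 0 is [rad 0 = 1]. *)
Definition rad (m : nat) : nat := (\prod_(p <- primes m) p)%N.

Definition abc_triple (t : nat * nat * nat) : Prop :=
  let: (a, b, c) := t in
  [/\ (0 < a)%N, (0 < b)%N & (0 < c)%N] /\
  [/\ coprime a b, coprime a c & coprime b c] /\
  (a + b)%N = c.

Definition abc_conjecture (R : realType) : Prop :=
  forall eps : R, 0 < eps ->
    finite_set [set t : nat * nat * nat | abc_triple t /\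
      let: (a, b, c) := t in
      ((rad (a * b * c)%N)%:R : R) `^ (1 + eps) < c%:R].

Definition collatz (n : nat) : nat :=
  (if odd n then (3 * n + 1) %/ 2 else n %/ 2)%N.

(* [traject collatz n j] lists the j terms n, T n, ..., T^(j-1) n, so even
   terms are counted by index, with multiplicity if a value recurs. *)
Definition one_even_set (j : nat) : set nat :=
  [set n | (0 < n < 2 ^ j)%N /\
           count (fun m => ~~ odd m) (traject collatz n j) = 1%N].

(* Main.v *)
(** The only even term occurs at some index [k]. The [k] odd steps before it force
    [n + 1 = 2^k m] with [k]-th iterate [3^k m - 1], and the odd steps after it
    force [3^k m + 1 = 2^(j-k) q]. The radical of [3^k m * 2^(j-k) q] is at
    most [6mq], so abc applied to this identity gives
    [2^(j-k) q <= C (6mq)^(1+d)]. Cancelling [q] leaves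
    [2^(j-k) <= 6 C m (6mq)^d], where [6mq <= 2^(4j+4)]; multiply by [2^k]. *)
Require Import Defs.
From HB Require Import structures.
From mathcomp Require Import all_boot all_order all_algebra.
From mathcomp Require Import all_classical all_reals all_analysis.
From mathcomp Require Import zify ring.

Set Implicit Arguments.
Unset Strict Implicit.
Unset Printing Implicit Defensive.

Import Order.TTheory GRing.Theory Num.Theory.

Local Open Scope classical_set_scope.
Local Open Scope ring_scope.

Lemma prod_primes_dvdn (s : seq nat) (d : nat) :
  uniq s -> {in s, forall p, prime p && (p %| d)%N} ->
  (\prod_(p <- s) p %| d)%N.
Proof.
elim: s => [|p s IHs] /=; first by rewrite big_nil.
case/andP=> ps us ds; rewrite big_cons Gauss_dvd.
  apply/andP; split; first by have /andP[] := ds p (mem_head _ _).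
  by apply: IHs => // q qs; apply: ds; rewrite inE qs orbT.
rewrite big_seq; apply: (big_ind (coprime p)) => [|x y|q qs].
- exact: coprimen1.
- by move=> px py; rewrite coprimeMr px.
have /andP[p_pr _] := ds p (mem_head _ _).
have /andP[q_pr _] : prime q && (q %| d)%N by apply: ds; rewrite inE qs orbT.
rewrite prime_coprime // dvdn_prime2 //.
by apply: contraNneq ps => ->.
Qed.

Lemma rad_leq (x d : nat) : (0 < d)%N ->
  (forall p, prime p -> (p %| x)%N -> (p %| d)%N) -> (Defs.rad x <= d)%N.
Proof.
move=> d0 xd; apply: dvdn_leq => //; apply: prod_primes_dvdn => [|p].
  exact: primes_uniq.
by rewrite mem_primes => /and3P[p_pr _ px]; rewrite p_pr xd.
Qed.

Lemma rad_gt0 (x : nat) : (0 < Defs.rad x)%N.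
Proof.
rewrite /Defs.rad big_seq; apply: (big_ind (fun i => 0 < i)%N) => [//|a b|p].
  by rewrite muln_gt0 => -> ->.
by rewrite mem_primes => /and3P[/prime_gt0].
Qed.

(** A prime dividing a power of 3 or of 2 divides 3 or 2 itself, so [6 * m * q] already contains
    every prime of the product. *)
Lemma rad_exp3_exp2 (k r m q : nat) : (0 < m)%N -> (0 < q)%N ->
  (Defs.rad (3 ^ k * m * (2 ^ r * q)) <= 6 * m * q)%N.
Proof.
move=> m0 q0; apply: rad_leq => [|p p_pr]; first by rewrite !muln_gt0 m0 q0.
have px e c : (p %| e ^ c)%N -> (p %| e)%N.
  by rewrite Euclid_dvdX // => /andP[].
rewrite (_ : 6 = 3 * 2)%N // !Euclid_dvdM //.
by case/orP=> /orP[/px ->|->]; rewrite ?orbT.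
Qed.

(** In the shifted variable [n.+1] an odd step is multiplication by 3/2, so a run of odd steps gives
    a pure power of 3/2. *)
Lemma double_collatz_odd (n : nat) : odd n ->
  (2 * (collatz n).+1 = 3 * n.+1)%N.
Proof. by rewrite /collatz => n_odd; rewrite n_odd; lia. Qed.

Lemma double_collatz_even (n : nat) : ~~ odd n -> (2 * collatz n = n)%N.
Proof. by rewrite /collatz => n_even; rewrite (negbTE n_even); lia. Qed.

Lemma odd_traject (k n : nat) : all odd (traject collatz n k) ->
  exists m, (n.+1 = 2 ^ k * m /\ (iter k collatz n).+1 = 3 ^ k * m)%N.
Proof.
elim: k n => [|k IHk] n /=; first by exists n.+1; rewrite !expn0 !mul1n.
case/andP=> n_odd /IHk[m [nm im]]; have nn := double_collatz_odd n_odd.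
(* The witness for [collatz n] is 3 times the one for [n]: twice [2 ^ k * m] equals [3 * n.+1], and
   3 is coprime to 2. *)
have /dvdnP[m' mm'] : (3 %| m)%N.
  have : (3 %| 2 ^ k.+1 * m)%N by rewrite expnS -mulnA -nm nn dvdn_mulr.
  by rewrite Gauss_dvdr // coprimeXr.
exists m'; rewrite -iterS iterSr im mm'; split; last by rewrite expnS; lia.
by rewrite expnS; move: nn; rewrite nm mm'; lia.
Qed.

Lemma count_even_eq1 (j n : nat) :
  count (fun m => ~~ odd m) (traject collatz n j) = 1%N ->
  exists k l, [/\ j = (k + l).+1, all odd (traject collatz n k),
    ~~ odd (iter k collatz n) &
    all odd (traject collatz (iter k.+1 collatz n) l)].
Proof.
elim: j n => [//|j IHj] n /=; case: (boolP (odd n)) => n_odd /=.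
  rewrite add0n => /IHj[k [l [jkl k_odd k_even l_odd]]].
  exists k.+1, l; split; first by rewrite jkl.
  - by rewrite /= n_odd.
  - by rewrite iterSr.
  - by rewrite iterSr.
move=> [c0]; exists 0%N, j; split => //.
apply/negPn/negP; rewrite -has_predC has_count; apply/negP.
by rewrite -leqNgt -[leqRHS]c0.
Qed.

(** If x is the even term and y its half, then x + 2 = 2(y + 1). With x + 1 = 3^k m, the even step
    thus adds one factor 2 to the 2^l that the [l] odd steps after it force in y + 1, whence
    [r = l.+1]. *)
Lemma one_even_factor (j n : nat) : one_even_set j n ->
  exists k r m q, [/\ j = (k + r)%N, n.+1 = (2 ^ k * m)%N &
    (3 ^ k * m).+1 = (2 ^ r * q)%N].
Proof.
case=> _ /count_even_eq1[k [l [-> /odd_traject[m [nm im]] k_even]]].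
case/odd_traject=> q [cq _].
exists k, l.+1, m, q; split; rewrite ?addnS //.
by rewrite -im expnS -mulnA -cq iterS; have := double_collatz_even k_even; lia.
Qed.

Lemma abc_bound (R : realType) : abc_conjecture R ->
  forall d : R, 0 < d -> exists C : R, 0 < C /\
    forall a b c : nat, abc_triple (a, b, c) ->
      c%:R <= C * (Defs.rad (a * b * c))%:R `^ (1 + d).
Proof.
move=> habc d d0; have /finite_seqP[s sE] := habc d d0.
(* This constant exceeds the [c] of each of the finitely many exceptional triples; since radicals
   are at least 1, it absorbs them all. *)
exists (\sum_(t <- s) t.2).+1%:R; split; first by rewrite ltr0n.
move=> a b c abc.
have rad1 : (1 : R) <= (Defs.rad (a * b * c))%:R `^ (1 + d).
  rewrite -[leLHS](powRr0 (Defs.rad (a * b * c))%:R); apply: ler_powR.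
    by rewrite ler1n rad_gt0.
  by rewrite addr_ge0 // ltW.
have [le_c|lt_c] := leP (c%:R : R) ((Defs.rad (a * b * c))%:R `^ (1 + d)).
  apply: (le_trans le_c); rewrite ler_peMl ?powR_ge0 //.
  by rewrite ler1n.
have ts : (a, b, c) \in s.
  suff : [set` s] (a, b, c) by [].
  by rewrite -sE.
apply: (@le_trans _ _ (\sum_(t <- s) t.2).+1%:R); last first.
  by rewrite ler_peMr.
by rewrite ler_nat (big_rem _ ts) /=; lia.
Qed.

Lemma abc_triple_succ (a : nat) : (0 < a)%N -> abc_triple (a, 1%N, a.+1).
Proof.
by move=> a0; rewrite /abc_triple coprimen1 coprime1n coprimenS addn1.
Qed.

(** A crude bound is enough, as the product will only enter to a small power. It follows from m <=
    2^j and 3^k <= 4^j, which give q <= 2 * 2^(3j). *)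
Lemma one_even_size (j k m q r n : nat) : (n < 2 ^ j)%N ->
  j = (k + r)%N -> n.+1 = (2 ^ k * m)%N -> (3 ^ k * m).+1 = (2 ^ r * q)%N ->
  (6 * m * q <= 2 ^ (4 * j + 4))%N.
Proof.
move=> nj jkr nm mq.
have m0 : (0 < m)%N by case: (m) nm => //; rewrite muln0.
have mj : (m <= 2 ^ j)%N.
  by apply: leq_trans nj; rewrite nm leq_pmull // expn_gt0.
have k4 : (3 ^ k <= 2 ^ j * 2 ^ j)%N.
  rewrite -expnMn; apply: (@leq_trans (4 ^ k)%N).
    by case: (k) => // i; rewrite leq_exp2r.
  by rewrite leq_pexp2l // jkr leq_addr.
have qb : (q <= 2 * (2 ^ j * 2 ^ j * 2 ^ j))%N.
  apply: (@leq_trans (3 ^ k * m).+1).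
    by rewrite mq leq_pmull // expn_gt0.
  have : (3 ^ k * m <= 2 ^ j * 2 ^ j * 2 ^ j)%N by apply: leq_mul.
  have : (0 < 3 ^ k * m)%N by rewrite muln_gt0 expn_gt0.
  by lia.
(* The factors multiply to 12 * 2^(4j), and 16 = 12 + 4. *)
rewrite (_ : 2 ^ (4 * j + 4) = 6 * 2 ^ j * (2 * (2 ^ j * 2 ^ j * 2 ^ j))
    + 4 * (2 ^ j * 2 ^ j * 2 ^ j * 2 ^ j))%N.
  by apply: leq_trans (leq_addr _ _); rewrite leq_mul // leq_mul2l mj.
by rewrite expnD (mulnC 4) expnM; ring.
Qed.

Theorem theorem1 (R : realType) (habc : abc_conjecture R) :
  forall eps : R, 0 < eps ->
    exists K : R, 0 < K /\
      forall j : nat, (2 <= j)%N ->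
      forall n : nat, one_even_set j n ->
        K * 2 `^ ((1 - eps) * j%:R) <= n%:R.
Proof.
(* With this [d], the size bound 2^(4j+4) raised to [d] is 2^eps * 2^(eps j), that is, [D * E]
   below. *)
move=> eps eps0; set d := eps / 4.
have d0 : 0 < d by rewrite divr_gt0.
have [C [C0 abcC]] := abc_bound habc d0.
set D : R := 2 `^ eps; have D0 : 0 < D by rewrite powR_gt0.
exists (12 * C * D)^-1; split; first by rewrite invr_gt0 !mulr_gt0.
move=> j _ n nj; have [/andP[n0 nlt] _] := nj.
have [k [r [m [q [jkr nm mq]]]]] := one_even_factor nj.
have m0 : (0 < m)%N by case: (m) nm => //; rewrite muln0.
have q0 : (0 < q)%N by case: (q) mq => //; rewrite muln0.
have a0 : (0 < 3 ^ k * m)%N by rewrite muln_gt0 expn_gt0.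
have := abcC _ _ _ (abc_triple_succ a0); rewrite muln1 mq => cC.
set M : R := (6 * m * q)%:R.
have M0 : 0 < M by rewrite ltr0n !muln_gt0 m0 q0.
have radM :
    (Defs.rad (3 ^ k * m * (2 ^ r * q)))%:R `^ (1 + d) <= M * M `^ d.
  rewrite -[X in X * _](powRr1 (ltW M0)) -powRD ?(gt_eqF M0) ?implybT //.
  apply: ge0_ler_powR; rewrite ?nnegrE ?ler0n ?addr_ge0 ?(ltW d0) //.
  by rewrite ler_nat rad_exp3_exp2.
have Md : M `^ d <= D * 2 `^ (eps * j%:R).
  have -> : D * 2 `^ (eps * j%:R) = (2 ^ (4 * j + 4))%:R `^ d.
    rewrite natrX -powR_mulrn // -powRrM /D -powRD ?pnatr_eq0 ?implybT //.
    by congr (_ `^ _); rewrite /d natrD natrM; field.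
  apply: ge0_ler_powR; rewrite ?nnegrE ?ler0n ?(ltW d0) //.
  by rewrite ler_nat (one_even_size nlt jkr nm mq).
set E : R := 2 `^ (eps * j%:R) in Md.
have E0 : 0 < E by rewrite powR_gt0.
have r_le : (2 ^ r)%:R <= C * (6 * m%:R * (D * E)) :> R.
  rewrite -(ler_pM2r (_ : 0 < q%:R :> R)) ?ltr0n //.
  rewrite -(natrM _ (2 ^ r)) (le_trans cC) //.
  rewrite -[leRHS]mulrA ler_pM2l // (le_trans radM) // [leRHS]mulrAC.
  by rewrite (_ : 6 * m%:R * q%:R = M) ?ler_pM2l // /M !natrM.
(* Passing from [n.+1] to [n] costs the factor 2 that turns 6 into the 12 of the constant. *)
have n1 : n.+1%:R <= 2 * n%:R :> R by rewrite -natrM ler_nat mul2n -addnn; lia.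
(* Since 2^((1-eps)j) = 2^j / [E], clearing denominators leaves 2^j <= 12 C D n E. *)
rewrite mulrBl mul1r powRB ?pnatr_eq0 ?implybT // powR_mulrn //.
rewrite ler_pdivrMl ?ler_pdivrMr ?mulr_gt0 // -/E.
rewrite jkr exprD -!natrX.
have k_gt0 : 0 < (2 ^ k)%:R :> R by rewrite ltr0n expn_gt0.
apply: (@le_trans _ _ ((2 ^ k)%:R * (C * (6 * m%:R * (D * E))))).
  by rewrite ler_pM2l.
have -> : (2 ^ k)%:R * (C * (6 * m%:R * (D * E))) = 6 * C * D * E * n.+1%:R.
  by rewrite nm natrM; ring.
have -> : 12 * C * D * n%:R * E = 6 * C * D * E * (2 * n%:R) by ring.
by rewrite ler_pM2l // !mulr_gt0.
Qed.
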